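(* Suppose $\bar\alpha\in\Delta^n$ satisfies the upper-bound condition $$q_{\bar\alpha}(\beta,x)\le h(\bar\alpha)\qquad\text{for every }\beta\in\Delta^n\text{ and every }x\in z^*(\beta).$$ Let $(\phi,z)$ be any stationary MPE and let $(\alpha_t,x_t)$ be its path from $\alpha_0=\bar\alpha$. Then for every $t\ge1$, $$q_{\bar\alpha}(\alpha_t,x_t)=h(\bar\alpha)\quad\text{and}\quad\alpha_t\in K(\bar\alpha).$$ In particular, if $K(\bar\alpha)\cap\mathcal P=\varnothing$, then $\varepsilon:=\operatorname{dist}(K(\bar\alpha),\mathcal P)>0$ and every such equilibrium path satisfies $\operatorname{dist}(\alpha_t,\mathcal P)\ge\varepsilon$ for every $t\ge1$; thus no stationary MPE starting from $\bar\alpha$ approaches the set of pure worldviews.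
   Context: Let $J=\{1,\ldots,n\}$ and $X$ be nonempty finite sets (pure worldviews and actions) with payoffs $u_j(x)\in\mathbb R$. $\Delta^n=\{\alpha\in\mathbb R^n:\alpha^j\ge0,\ \sum_j\alpha^j=1\}$ is the set of worldviews; $\alpha(j)$ is the vertex with weight one on $j$; $\mathcal P=\{\alpha(1),\ldots,\alpha(n)\}$. $U(\alpha,x)=\sum_j\alpha^ju_j(x)$, $z^*(\alpha)=\arg\max_{x\in X}U(\alpha,x)$, $h(\alpha)=\max_{x\in X}U(\alpha,x)$. Distances are in the $\ell^1$ norm. Parameters $0<\delta<1$, $0<\lambda<1$. For a fixed current worldview $\bar\alpha$, define $$q_{\bar\alpha}(\beta,x)=(1-\lambda)U(\beta,x)+\lambda U(\bar\alpha,x),\qquad K(\bar\alpha)=\{\beta\in\Delta^n:\exists x\in z^*(\beta)\text{ with }q_{\bar\alpha}(\beta,x)=h(\bar\alpha)\}.$$ A stationary pure strategy is a pair of arbitrary maps $\phi:\Delta^n\to\Delta^n$, $z:\Delta^n\to X$ (no continuity or measurability assumed). With $\phi^k$ the $k$-fold iterate, put $$C_{\phi,z}(\beta;\alpha)=\sum_{k=0}^\infty\delta^k\big[(1-\lambda)U(\phi^k(\beta),z(\phi^k(\beta)))+\lambda U(\alpha,z(\phi^k(\beta)))\big].$$ A stationary MPE is a pair $(\phi,z)$ such that for every $\alpha\in\Delta^n$: $z(\alpha)\in z^*(\alpha)$, and $C_{\phi,z}(\phi(\alpha);\alpha)\ge C_{\phi,z}(\beta;\alpha)$ for every $\beta\in\Delta^n$.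 The induced path from $\alpha_0$ is $\alpha_{t+1}=\phi(\alpha_t)$, $x_t=z(\alpha_t)$. *)

(* Defs.v *)
From HB Require Import structures.
From mathcomp Require Import all_boot all_order all_algebra.
From mathcomp Require Import all_classical all_reals all_analysis.

Set Implicit Arguments.
Unset Strict Implicit.
Unset Printing Implicit Defensive.

Import Order.TTheory GRing.Theory Num.Theory.
Import numFieldNormedType.Exports.

Local Open Scope classical_set_scope.
Local Open Scope ring_scope.

Section Simplex.
Context {R : realType} {n : nat}.

Definition simplex : {pred 'rV[R]_n} :=
  [pred a : 'rV[R]_n | [forall j, 0 <= a ord0 j] && (\sum_j a ord0 j == 1)].

Record worldview := Worldview {
  weights :> 'rV[R]_n;
  weightsP : weights \in simplex }.

HB.instance Definition _ := [isSub for weights].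

Lemma delta_simplex (j : 'I_n) : delta_mx 0 j \in simplex.
Proof.
rewrite inE; apply/andP; split.
  by apply/forallP => i; rewrite mxE ler0n.
rewrite (bigD1 j) //= mxE !eqxx big1 ?addr0 // => i /negbTE ij.
by rewrite mxE ij andbF.
Qed.

Definition vertex (j : 'I_n) : worldview := Worldview (delta_simplex j).

Definition pure_worldviews : set worldview := range vertex.

Definition l1dist (a b : worldview) : R := \sum_j `|a ord0 j - b ord0 j|.

(* The real infimum is the usual distance for nonempty sets; it is 0 by
   convention when one of the sets is empty. *)
Definition dist (A B : set worldview) : R :=
  inf [set l1dist a b | a in A & b in B].

(* [s] has points arbitrarily close to [A]; this is weaker than
   convergence of the distance to 0. *)
Definition approaches (s : nat -> worldview) (A : set worldview) : Prop :=
  forall e : R, 0 < e -> exists t : nat, dist [set s t] A < e.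

End Simplex.
Arguments worldview : clear implicits.
Arguments pure_worldviews : clear implicits.

Section Model.
Context {R : realType} {n : nat} {X : finType}.
Variable u : 'I_n -> X -> R.
Implicit Types (a b : worldview R n) (x : X).

Definition U a x : R := \sum_j a ord0 j * u j x.

Definition zstar a : set X := [set x | forall y, U a y <= U a x].

(* The value does not depend on [x0], which witnesses that X is nonempty. *)
Definition h (x0 : X) a : R := \big[Num.max/U a x0]_(x : X) U a x.

(* Flow payoff of action [x] under worldview [b], evaluated from the current
   worldview [a]. *)
Definition q (lambda : R) a b x : R :=
  (1 - lambda) * U b x + lambda * U a x.

Definition K (lambda : R) (x0 : X) a : set (worldview R n) :=
  [set b | exists2 x, zstar b x & q lambda a b x = h x0 a].

(* Discounted value, evaluated from the current worldview [a], of moving to [b]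
   and following [(phi, z)] from there. The series converges absolutely for
   [0 < delta < 1], payoffs being bounded. *)
Definition C (delta lambda : R) (phi : worldview R n -> worldview R n)
    (z : worldview R n -> X) b a : R :=
  limn (series (fun k : nat =>
    delta ^+ k * q lambda a (iter k phi b) (z (iter k phi b)))).

Definition stationary_MPE (delta lambda : R)
    (phi : worldview R n -> worldview R n) (z : worldview R n -> X) : Prop :=
  forall a, zstar a (z a) /\
    forall b, C delta lambda phi z b a <= C delta lambda phi z (phi a) a.

End Model.

(* Main.v *)
(* Staying put for one period and then moving to [phi abar] is a deviation
   worth [h + delta * C], where [C] is the value of moving to [phi abar] at
   once, because the flow payoff at [abar] itself is [h]. Optimality gives
   [C >= h / (1 - delta)], while the upper bound caps every flow payoff by [h].
   So the discounted sum of the nonnegative gaps to [h] vanishes, and with it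
   every gap. For the distance, a vertex outside [K] fails, for each action, one
   of two conditions stable under small perturbations, payoffs being Lipschitz
   for the l1 distance; vertices and actions are finite in number. *)

Require Import Defs.
From HB Require Import structures.
From mathcomp Require Import all_boot all_order all_algebra.
From mathcomp Require Import all_classical all_reals all_analysis.
From mathcomp Require Import lra.

Set Implicit Arguments.
Unset Strict Implicit.
Unset Printing Implicit Defensive.

Import Order.TTheory GRing.Theory Num.Theory.
Import numFieldNormedType.Exports.

Local Open Scope classical_set_scope.
Local Open Scope ring_scope.

(** * Convergence of discounted sums and the equality case of their upper bound *)

Section DiscountedSum.
Context {R : realType}.
Variables (d M : R) (f : R ^nat).
Hypotheses (d01 : 0 < d < 1) (fM : forall k, `|f k| <= M).

Lemma discounted_cvg : cvgn (series (fun k => d ^+ k * f k)).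
Proof.
have [d0 d1] := andP d01.
have dk0 k : 0 <= d ^+ k by rewrite exprn_ge0 // ltW.
have M0 : 0 <= M by exact: le_trans (fM 0).
apply: normed_cvg; apply: (@series_le_cvg _ _ (geometric M d)).
- by move=> k /=.
- by move=> k /=; rewrite mulr_ge0.
- by move=> k /=; rewrite normrM ger0_norm // mulrC ler_wpM2r.
- by apply: is_cvg_geometric_series; rewrite ger0_norm // ltW.
Qed.

Lemma discounted_eq_bound (c : R) :
    (forall k, f k <= c) ->
    c <= (1 - d) * limn (series (fun k => d ^+ k * f k)) ->
  forall k, f k = c.
Proof.
move=> fc cD k; have [d0 d1] := andP d01.
have Nd1 : `|d| < 1 by rewrite ger0_norm // ltW.
pose gap := geometric c d - (fun k => d ^+ k * f k).
have gapE i : gap i = d ^+ i * (c - f i).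
  by rewrite /gap !fctE /= mulrBr mulrC.
have gap_ge0 i : 0 <= gap i.
  by rewrite gapE mulr_ge0 ?subr_ge0 // exprn_ge0 // ltW.
have cc := @is_cvg_geometric_series R c d Nd1.
have gap_cvg : cvgn (series gap) := is_cvg_seriesB cc discounted_cvg.
have lim_gap : limn (series gap) <= 0.
  rewrite (lim_seriesB cc discounted_cvg).
  (* The constant [c] has discounted sum [c / (1 - d)], which the hypothesis on [c] places below
     that of [f]. *)
  rewrite (cvg_lim _ (cvg_geometric_series Nd1)) // subr_le0.
  by rewrite ler_pdivrMr ?subr_gt0 // mulrC.
have sum_gap_le0 i : series gap i <= 0.
  apply: le_trans lim_gap; apply: nondecreasing_cvgn_le => //.
  by apply: nondecreasing_series => j _ _; exact: gap_ge0.
have sum_gap_ge0 i : 0 <= series gap i.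
  by rewrite seriesEord /= sumr_ge0.
(* Each gap is the difference of two consecutive partial sums, all of which are squeezed to 0. *)
have : gap k = 0.
  apply/eqP; rewrite eq_le gap_ge0 andbT.
  have := sum_gap_le0 k.+1; have := sum_gap_ge0 k.
  by rewrite seriesSr; lra.
rewrite gapE => /eqP; rewrite mulf_eq0 expf_eq0 (gt_eqF d0) andbF /=.
by rewrite subr_eq0 => /eqP.
Qed.

End DiscountedSum.

(** The identity already holds for partial sums with [m.+1] terms on the left and [m] on the right.
    It serves to split off the period of staying put. *)
Lemma discounted_recl {R : realType} (d M : R) (f : R ^nat) :
    0 < d < 1 -> (forall k, `|f k| <= M) ->
  limn (series (fun k => d ^+ k * f k)) =
  f 0%N + d * limn (series (fun k => d ^+ k * f k.+1)).
Proof.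
move=> d01 fM; apply: cvg_lim => //; rewrite -cvg_shiftS.
rewrite (_ : [sequence _]_m =
    (fun m => f 0%N + d * series (fun k => d ^+ k * f k.+1) m)); last first.
  apply/funext => m /=; rewrite !seriesEord /= big_ord_recl expr0 mul1r.
  by rewrite mulr_sumr; congr (_ + _); apply: eq_bigr => i _; rewrite exprS mulrA.
apply: cvgD; first exact: cvg_cst.
by apply: cvgMl_tmp; exact: (discounted_cvg d01 (fun k => fM k.+1)).
Qed.

(** * The l1 distance between sets of worldviews *)

Section Worldviews.
Context {R : realType} {n : nat}.
Implicit Types (a b : worldview R n) (A B : set (worldview R n)).

Lemma worldview_ge0 a j : 0 <= a ord0 j.
Proof. by have /andP[/forallP] := weightsP a. Qed.

Lemma worldview_sum a : \sum_j a ord0 j = 1.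
Proof. by have /andP[_ /eqP] := weightsP a. Qed.

Lemma l1dist_ge0 a b : 0 <= l1dist a b.
Proof. by apply: sumr_ge0 => j _. Qed.

(** Nonemptiness rules out the empty infimum, whose value 0 would break the bound for positive
    [e]. *)
Lemma le_dist A B (e : R) : A !=set0 -> B !=set0 ->
  (forall a b, A a -> B b -> e <= l1dist a b) -> e <= dist A B.
Proof.
move=> [a Aa] [b Bb] eAB; apply: lb_le_inf.
  by exists (l1dist a b); exists a => //; exists b.
by move=> _ [a' Aa' [b' Bb' <-]]; exact: eAB.
Qed.

Lemma dist_le A B a b : A a -> B b -> dist A B <= l1dist a b.
Proof.
move=> Aa Bb; apply: ge_inf; last by exists a => //; exists b.
by exists 0 => _ [a' _ [b' _ <-]]; exact: l1dist_ge0.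
Qed.

Lemma pure_worldviews_neq0 : (0 < n)%N -> pure_worldviews R n !=set0.
Proof. by move=> n0; exists (vertex (Ordinal n0)); exists (Ordinal n0). Qed.

Lemma dist_set1_le A B a : A a -> B !=set0 -> dist A B <= dist [set a] B.
Proof.
move=> Aa B0; apply: le_dist => //; first by exists a.
by move=> _ b -> Bb; exact: dist_le.
Qed.

End Worldviews.

(** * Payoff estimates, separation of [K] from the vertices, equilibrium paths *)

Section Payoffs.
Context {R : realType} {n : nat} {X : finType}.
Variable u : 'I_n -> X -> R.
Implicit Types (a b : worldview R n) (x : X).

(** One constant serves both as a uniform bound on flow payoffs and as their Lipschitz constant. *)
Definition payoff_bound : R := \big[Num.max/0]_(p : 'I_n * X) `|u p.1 p.2|.

Lemma payoff_bound_ge0 : 0 <= payoff_bound.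
Proof. exact: bigmax_ge_id. Qed.

Lemma payoff_le_bound j x : `|u j x| <= payoff_bound.
Proof. exact: (le_bigmax 0 (fun p : 'I_n * X => `|u p.1 p.2|) (j, x)). Qed.

Lemma U_bounded a x : `|U u a x| <= payoff_bound.
Proof.
apply: (le_trans (ler_norm_sum _ _ _)).
rewrite -[leRHS]mulr1 -(worldview_sum a) mulr_sumr; apply: ler_sum => j _.
by rewrite normrM ger0_norm ?worldview_ge0 // mulrC ler_wpM2r
  ?worldview_ge0 ?payoff_le_bound.
Qed.

Lemma U_lipschitz a b x : `|U u a x - U u b x| <= payoff_bound * l1dist a b.
Proof.
rewrite /U -sumrB mulr_sumr; apply: (le_trans (ler_norm_sum _ _ _)).
apply: ler_sum => j _; rewrite -mulrBl normrM mulrC.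
by rewrite ler_wpM2r ?payoff_le_bound.
Qed.

Lemma h_zstar x0 a x : zstar u a x -> h u x0 a = U u a x.
Proof.
move=> ax; apply/eqP; rewrite eq_le; apply/andP; split; last exact: le_bigmax.
by apply: bigmax_le => [|y _]; exact: ax.
Qed.

Lemma q_self (lambda : R) a x : q u lambda a a x = U u a x.
Proof. by rewrite /q -mulrDl subrK mul1r. Qed.

Lemma q_bounded (lambda : R) a b x : 0 < lambda < 1 ->
  `|q u lambda a b x| <= payoff_bound.
Proof.
move=> /andP[l0 l1]; apply: (le_trans (ler_normD _ _)).
rewrite !normrM (ger0_norm (ltW l0)) (@ger0_norm _ (1 - lambda)); last first.
  by rewrite subr_ge0 ltW.
have -> : payoff_bound = (1 - lambda) * payoff_bound + lambda * payoff_bound.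
  by rewrite -mulrDl subrK mul1r.
by rewrite lerD // ler_wpM2l ?U_bounded ?subr_ge0 // ltW.
Qed.

(** The terms in [U u a x] cancel, and the remaining factor [1 - lambda] is at most 1. *)
Lemma q_lipschitz (lambda : R) a b c x : 0 < lambda < 1 ->
  `|q u lambda a b x - q u lambda a c x| <= payoff_bound * l1dist b c.
Proof.
move=> /andP[l0 l1]; rewrite /q opprD addrACA subrr addr0 -mulrBr normrM.
rewrite (@ger0_norm _ (1 - lambda)) ?subr_ge0 ?(ltW l1) //.
apply: le_trans (U_lipschitz b c x).
by rewrite ler_piMl // gerBl ltW.
Qed.

(* The [+ 1] keeps the denominator positive when all payoffs vanish. *)
Lemma gap_le_l1dist (c g : R) a b : 0 <= c -> g <= c * l1dist a b ->
  g / (c + 1) <= l1dist a b.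
Proof.
move=> c0 gc; rewrite ler_pdivrMr ?ltr_wpDl // mulrC mulrDl mul1r.
by rewrite (le_trans gc) // lerDl l1dist_ge0.
Qed.

Lemma K_action_away (lambda : R) x0 a v x :
    0 < lambda < 1 -> ~ K u lambda x0 a v ->
  exists2 e : R, 0 < e & forall b, zstar u b x ->
    q u lambda a b x = h u x0 a -> e <= l1dist b v.
Proof.
move=> l01 nKv; have M0 := payoff_bound_ge0.
have [vx|/existsNP[y /negP]] := pselect (zstar u v x); last first.
  rewrite -ltNge => vxy.
  (* Here [y] beats [x] at [v]. Where [x] is optimal this advantage is gone, and both payoffs may
     have moved, whence the factor 2. *)
  exists ((U u v y - U u v x) / (payoff_bound * 2 + 1)).
    by rewrite divr_gt0 ?subr_gt0 // ltr_wpDl // mulr_ge0.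
  move=> b bx _; apply: gap_le_l1dist; first by rewrite mulr_ge0.
  have := bx y; have := U_lipschitz b v x; have := U_lipschitz b v y.
  by rewrite !ler_norml => /andP[? ?] /andP[? ?] ?; lra.
(* Here [x] is optimal at [v], so the gap to [h] is nonzero: otherwise [x] would put [v] in [K]. *)
exists (`|q u lambda a v x - h u x0 a| / (payoff_bound + 1)).
  rewrite divr_gt0 ?ltr_wpDl // normr_gt0 subr_eq0.
  by apply/eqP => qh; apply: nKv; exists x.
move=> b _ <-; apply: gap_le_l1dist => //.
by rewrite distrC; exact: q_lipschitz.
Qed.

Lemma dist_K_pure_gt0 (lambda : R) x0 a :
    (0 < n)%N -> 0 < lambda < 1 -> K u lambda x0 a !=set0 ->
    K u lambda x0 a `&` pure_worldviews R n = set0 ->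
  0 < dist (K u lambda x0 a) (pure_worldviews R n).
Proof.
move=> n0 l01 K0 KP.
have away (p : 'I_n * X) : exists e : R, 0 < e /\ forall b, zstar u b p.2 ->
    q u lambda a b p.2 = h u x0 a -> e <= l1dist b (vertex p.1).
  have nK : ~ K u lambda x0 a (vertex p.1).
    move=> Kv; have : (K u lambda x0 a `&` pure_worldviews R n) (vertex p.1).
      by split=> //; exists p.1.
    by rewrite KP.
  by have [e e0 He] := @K_action_away lambda x0 a (vertex p.1) p.2 l01 nK; exists e.
have [e He] := choice away.
(* A minimum over finitely many pairs of a vertex and an action stays positive; [1] is just a
   positive starting value. *)
apply: (@lt_le_trans _ _ (\big[Num.min/1]_p e p)).
  by apply: lt_bigmin => // p _; have [] := He p.
apply: le_dist => //; first exact: pure_worldviews_neq0.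
move=> b _ [x bx qx] [j _ <-].
apply: le_trans (bigmin_le 1 (j, x) e) _.
by have [_] := He (j, x); apply.
Qed.

Lemma MPE_path_q (delta lambda : R) x0 a phi z :
    0 < delta < 1 -> 0 < lambda < 1 ->
    (forall b x, zstar u b x -> q u lambda a b x <= h u x0 a) ->
    stationary_MPE u delta lambda phi z ->
  forall t, q u lambda a (iter t phi a) (z (iter t phi a)) = h u x0 a.
Proof.
move=> d01 l01 ub mpe.
have zP b : zstar u b (z b) by have [] := mpe b.
case=> [|t]; first by rewrite q_self (h_zstar x0 (zP a)).
(* From time 1 on, the path is the orbit of [phi a], so time [t.+1] is index [t] of the sequence
   [f (phi a)]. *)
rewrite iterSr.
pose f b k := q u lambda a (iter k phi b) (z (iter k phi b)).
have fM b k : `|f b k| <= payoff_bound by exact: q_bounded.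
apply: (discounted_eq_bound d01 (fM (phi a))) => [k|]; first exact: ub.
(* The deviation is to [a] itself. It yields [h + delta * C <= C], hence [h <= (1 - delta) * C]. *)
have [_ /(_ a)] := mpe a; rewrite [leLHS](discounted_recl d01 (fM a)).
rewrite [f a 0%N]q_self -(h_zstar x0 (zP a)).
rewrite [X in _ + delta * X <= _](_ : _ = C u delta lambda phi z (phi a) a).
  by rewrite -/(C u delta lambda phi z (phi a) a); lra.
rewrite /C; congr (limn (series _)); apply/funext => k.
by rewrite /f iterSr.
Qed.

Lemma MPE_path_K (delta lambda : R) x0 a phi z :
    0 < delta < 1 -> 0 < lambda < 1 ->
    (forall b x, zstar u b x -> q u lambda a b x <= h u x0 a) ->
    stationary_MPE u delta lambda phi z ->
  forall t, K u lambda x0 a (iter t phi a).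
Proof.
move=> d01 l01 ub mpe t; exists (z (iter t phi a)).
  by have [] := mpe (iter t phi a).
exact: MPE_path_q mpe t.
Qed.

Lemma zstar_neq0 (x0 : X) a : zstar u a !=set0.
Proof.
exists [arg max_(x > x0) U u a x]%O => y.
by case: arg_maxP => // x _; apply.
Qed.

(** This makes [K] nonempty without appeal to any equilibrium, as the positivity of its distance to
    the vertices requires. *)
Lemma K_self (lambda : R) x0 a : K u lambda x0 a a.
Proof.
by have [x ax] := zstar_neq0 x0 a; exists x => //; rewrite q_self (h_zstar x0 ax).
Qed.

End Payoffs.

Theorem theorem3 (R : realType) (n : nat) (n_gt0 : (0 < n)%N)
    (X : finType) (x0 : X) (u : 'I_n -> X -> R)
    (delta lambda : R) (delta01 : 0 < delta < 1) (lambda01 : 0 < lambda < 1)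
    (abar : worldview R n)
    (upper_bound : forall (b : worldview R n) (x : X),
       zstar u b x -> q u lambda abar b x <= h u x0 abar) :
  (forall (phi : worldview R n -> worldview R n) (z : worldview R n -> X),
     stationary_MPE u delta lambda phi z ->
     forall t : nat, (1 <= t)%N ->
       q u lambda abar (iter t phi abar) (z (iter t phi abar)) = h u x0 abar /\
       K u lambda x0 abar (iter t phi abar)) /\
  (K u lambda x0 abar `&` pure_worldviews R n = set0 ->
   0 < dist (K u lambda x0 abar) (pure_worldviews R n) /\
   forall (phi : worldview R n -> worldview R n) (z : worldview R n -> X),
     stationary_MPE u delta lambda phi z ->
     (forall t : nat, (1 <= t)%N ->
        dist (K u lambda x0 abar) (pure_worldviews R n) <=
        dist [set iter t phi abar] (pure_worldviews R n)) /\
     ~ approaches (fun t => iter t phi abar) (pure_worldviews R n)).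
Proof.
split=> [phi z mpe t _|KP].
  by split; [exact: MPE_path_q mpe t | exact: MPE_path_K mpe t].
have P0 := @pure_worldviews_neq0 R n n_gt0.
have dist_gt0 := dist_K_pure_gt0 n_gt0 lambda01
  (ex_intro _ _ (K_self u lambda x0 abar)) KP.
split=> // phi z mpe.
(* Time 0 is included because [approaches] ranges over all times. *)
have away t : dist (K u lambda x0 abar) (pure_worldviews R n) <=
    dist [set iter t phi abar] (pure_worldviews R n).
  by apply: dist_set1_le => //; exact: MPE_path_K mpe t.
by split=> // /(_ _ dist_gt0) [t]; rewrite ltNge away.
Qed.
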